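(* Let $K$ be a field, $S=K[x_1,\ldots,x_n]$, and let $I\subset S$ be a polymatroidal ideal. Then $I$ has the persistence property.
   Context: A discrete polymatroid on $[n]=\{1,\ldots,n\}$ is a nonempty finite set $\mathcal P\subset \mathbb Z_{\ge 0}^n$ such that: (1) if $u\in\mathcal P$, $v\in\mathbb Z_{\ge0}^n$ and $v\le u$ componentwise, then $v\in\mathcal P$; (2) if $u,v\in\mathcal P$ with $|u|<|v|$ (where $|u|=\sum_i u(i)$), then there is $i$ with $u(i)<v(i)$ and $u+\varepsilon_i\in\mathcal P$, where $\varepsilon_i$ is the $i$th canonical basis vector. Its set of bases $B(\mathcal P)$ consists of the elements of $\mathcal P$ that are maximal with respect to $\le$; they all have the same modulus. Writing $x^u=\prod_i x_i^{u(i)}$, a polymatroidal ideal is a monomial ideal of $S$ whose set of minimal monomial generators is $\{x^u : u\in B(\mathcal P)\}$ for some discrete polymatroid $\mathcal P$ on $[n]$. $\operatorname{Ass}(J)$ denotes the set of associated prime ideals of $S/J$. $I$ has the persistence property if for every $k\ge 1$ and every $P\in\operatorname{Ass}(I^k)$ one has $P\in\operatorname{Ass}(I^{k+1})$. *)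

(* Defs.v *)
From HB Require Import structures.
From mathcomp Require Import all_boot all_order all_algebra.
From mathcomp Require Import finmap.
From mathcomp Require Export mpoly.

Set Implicit Arguments.
Unset Strict Implicit.
Unset Printing Implicit Defensive.

Import GRing.Theory.
Local Open Scope ring_scope.

(* Ideals are Prop-valued predicates, compared extensionally (by <->): the
   library's [idealr] takes boolean predicates and only covers proper ideals. *)
Section Ideals.

Variable R : comNzRingType.
Implicit Types (A I J Q : R -> Prop).

Definition is_ideal I : Prop :=
  [/\ I 0,
      forall f g, I f -> I g -> I (f + g)
    & forall a f, I f -> I (a * f)].

Definition ideal_gen A : R -> Prop := fun f =>
  exists s : seq (R * R),
    (forall p, p \in s -> A p.2) /\ f = \sum_(p <- s) p.1 * p.2.

Definition ideal_mul I J : R -> Prop :=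
  ideal_gen (fun h => exists f g, [/\ I f, J g & h = f * g]).

Fixpoint ideal_exp I (k : nat) : R -> Prop :=
  if k is k'.+1 then ideal_mul I (ideal_exp I k') else fun _ => True.

Definition is_prime_ideal Q : Prop :=
  [/\ is_ideal Q,
      ~ Q 1
    & forall f g, Q (f * g) -> Q f \/ Q g].

(* [Ass J Q]: Q is a prime ideal that is the annihilator of an element of the
   R-module R/J, that element being the class of f. *)
Definition Ass J Q : Prop :=
  is_prime_ideal Q /\ exists f, forall g, Q g <-> J (g * f).

Definition persistence_property I : Prop :=
  forall k : nat, (1 <= k)%N ->
  forall Q, Ass (ideal_exp I k) Q -> Ass (ideal_exp I k.+1) Q.

End Ideals.

(* On 'X_{1..n}, [(u <= v)%MM] is the componentwise order, whereas [(u <= v)%O]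
   would be a total monomial order. *)
Section Polymatroids.

Variable n : nat.

Definition discrete_polymatroid (P : {fset 'X_{1..n}}) : Prop :=
  [/\ P != fset0,
      forall u v : 'X_{1..n}, u \in P -> (v <= u)%MM -> v \in P
    & forall u v : 'X_{1..n}, u \in P -> v \in P -> (mdeg u < mdeg v)%N ->
        exists i : 'I_n, (u i < v i)%N /\ (u + U_(i))%MM \in P].

Definition is_base (P : {fset 'X_{1..n}}) (u : 'X_{1..n}) : Prop :=
  u \in P /\ forall v : 'X_{1..n}, v \in P -> (u <= v)%MM -> v = u.

End Polymatroids.

Section MonomialIdeals.

Variables (n : nat) (K : fieldType).
Implicit Type I : {mpoly K[n]} -> Prop.

Definition monomial_ideal I : Prop :=
  exists M : 'X_{1..n} -> Prop,
    forall f, I f <-> ideal_gen (fun g => exists u, M u /\ g = 'X_[u]) f.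

(* The minimal monomial generators of a monomial ideal are the monomials in it
   that are minimal for divisibility; [u] is the exponent of such a monomial. *)
Definition min_mon_gen I (u : 'X_{1..n}) : Prop :=
  I 'X_[u] /\ forall v : 'X_{1..n}, I 'X_[v] -> (v <= u)%MM -> v = u.

Definition polymatroidal_ideal I : Prop :=
  monomial_ideal I /\
  exists P : {fset 'X_{1..n}},
    discrete_polymatroid P /\ forall u, min_mon_gen I u <-> is_base P u.

End MonomialIdeals.

(* Main.v *)
(* Let B be the set of bases, so that I^k is generated by the monomials with
   exponent in the k-fold sumset kB. The point is that I^(k+1) : I = I^k. The
   one-sided exchange properties pass from B to kB, and they imply that if no
   element of kB lies below w, then w(A) < min_(z in kB) z(A) for some A, where
   z(A) is the sum of z over A. Taking u in B with u(A) minimal, w + u lies above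
   no element of (k+1)B, that is, x^w x^u is not in I^(k+1).
   If now Q = I^k : f, then Q is the intersection over u in B of the ideals
   I^(k+1) : f x^u, hence, being prime, equal to one of them. *)
Require Import Defs.
From mathcomp Require Import all_boot all_order all_algebra.
From mathcomp Require Import finmap zify.
From Stdlib Require Import ClassicalEpsilon.

Set Implicit Arguments.
Unset Strict Implicit.
Unset Printing Implicit Defensive.

Import GRing.Theory.

(** * Exchange properties of sets of exponents, and separation by sets of indices *)

Section Exchange.

Variable n : nat.
Implicit Types (C D : 'X_{1..n} -> Prop) (u v w x y z : 'X_{1..n}).
Implicit Types (i j l : 'I_n) (A : {set 'I_n}).

(* [x'] is [x - U_(i) + U_(j)] if [s] and [x + U_(i) - U_(j)] otherwise, written
   without truncated subtraction. *)
Definition exchange (s : bool) C := forall x y i, C x -> C y ->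
  (if s then y i < x i else x i < y i) ->
  exists j x', [/\ C x', if s then x j < y j else y j < x j
    & if s then (x' + U_(i) = x + U_(j))%MM else (x' + U_(j) = x + U_(i))%MM].

Definition sumset C D : 'X_{1..n} -> Prop :=
  fun w => exists u v, [/\ C u, D v & w = (u + v)%MM].

(** Subtraction is truncated, so this adds up the positive parts of [z - w] and vanishes exactly
    when [z] lies below [w]; [dist] is then the l1 distance. *)
Definition excess z w := \sum_l (z l - w l).

Definition dist x y := excess x y + excess y x.

Lemma mnm_moveP x x' i j : (x' + U_(i) = x + U_(j))%MM <->
  (forall l, x' l + (i == l) = x l + (j == l)).
Proof.
split=> [/mnmP h l|h]; first by have := h l; rewrite !mnmDE !mnm1E.
by apply/mnmP=> l; rewrite !mnmDE !mnm1E.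
Qed.

Lemma excess_move z z' w i j : (z' + U_(i) = z + U_(j))%MM ->
  w i < z i -> z j < w j -> excess z' w < excess z w.
Proof.
move=> /mnm_moveP h hi hj; rewrite /excess (bigD1 i) //= [ltnRHS](bigD1 i) //=.
rewrite -addSn leq_add //.
  have := h i; rewrite eqxx; case: (eqVneq j i) => [e|_] /=; last lia.
  by rewrite e in hj; lia.
apply: leq_sum => l li; have := h l; rewrite eq_sym (negbTE li).
by case: (eqVneq j l) => [<-|_] /=; lia.
Qed.

Lemma excess_moveC z z' w i j : (z' + U_(i) = z + U_(j))%MM ->
  w i < z i -> z j < w j -> excess w z' < excess w z.
Proof.
move=> /mnm_moveP h hi hj; rewrite /excess (bigD1 j) //= [ltnRHS](bigD1 j) //=.
rewrite -addSn leq_add //.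
  have := h j; rewrite eqxx; case: (eqVneq i j) => [e|_] /=; last lia.
  by rewrite e in hi; lia.
apply: leq_sum => l li; have := h l; rewrite [j == l]eq_sym (negbTE li).
by case: (eqVneq i l) => [<-|_] /=; lia.
Qed.

Lemma dist_move (s : bool) x x' y i j :
  (if s then y i < x i else x i < y i) ->
  (if s then x j < y j else y j < x j) ->
  (if s then (x' + U_(i) = x + U_(j))%MM else (x' + U_(j) = x + U_(i))%MM) ->
  dist x' y < dist x y.
Proof.
rewrite /dist; case: s => hi hj mv.
  by have := excess_move mv hi hj; have := excess_moveC mv hi hj; lia.
by have := excess_move mv hj hi; have := excess_moveC mv hj hi; lia.
Qed.

(* Exchanging in one summand may overshoot at a new index; one exchanges again
   there, and each step brings the summands of [x] closer to those of [y]. *)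
Lemma exchange_sumset s C D :
  exchange s C -> exchange s D -> exchange s (sumset C D).
Proof.
move=> eC eD x _ i [x1 [x2 [Cx1 Dx2 ex]]] [y1 [y2 [Cy1 Dy2 ->]]] hi.
pose y := (y1 + y2)%MM.
pose linked (x' : 'X_{1..n}) a := if s then (x' + U_(i) = x + U_(a))%MM
  else (x' + U_(a) = x + U_(i))%MM.
(* Here [u + v] is [x] with one unit moved between [i] and [a], on the wrong side of [y] at [a]; for
   [a = i] it is [x] itself. *)
suff main N a u v : dist u y1 + dist v y2 < N -> C u -> D v ->
    linked (u + v)%MM a ->
    (if s then y a < (u + v)%MM a else (u + v)%MM a < y a) ->
    exists j x', [/\ sumset C D x', if s then x j < y j else y j < x j
      & linked x' j].
  by apply: (main _ i x1 x2 (ltnSn _)); rewrite // /linked -ex ?if_same.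
elim: N a u v => // N IH a u v hN Cu Dv hl ha.
have [b [u' [v' [Cu' Dv' hd lb]]]] : exists b u' v', [/\ C u', D v',
    dist u' y1 + dist v' y2 < dist u y1 + dist v y2 & linked (u' + v')%MM b].
  have {ha} [hu|hv] : (if s then y1 a < u a else u a < y1 a) \/
      (if s then y2 a < v a else v a < y2 a).
  - by move: ha; rewrite /y !mnmDE; case: (s); lia.
  - have [b [u' [Cu' hb mv]]] := eC _ _ _ Cu Cy1 hu.
    exists b, u', v; split=> //; first by rewrite ltn_add2r (dist_move hu hb mv).
    move: hl mv; rewrite /linked; case: (s) => hl mv; apply/mnmP=> l;
    by move/mnmP/(_ l): hl; move/mnmP/(_ l): mv; rewrite !mnmDE; lia.
  - have [b [v' [Dv' hb mv]]] := eD _ _ _ Dv Dy2 hv.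
    exists b, u, v'; split=> //; first by rewrite ltn_add2l (dist_move hv hb mv).
    move: hl mv; rewrite /linked; case: (s) => hl mv; apply/mnmP=> l;
    by move/mnmP/(_ l): hl; move/mnmP/(_ l): mv; rewrite !mnmDE; lia.
have [hyb|hyb] := boolP (if s then y b < (u' + v')%MM b else (u' + v')%MM b < y b).
  by apply: IH hyb => //; lia.
exists b, (u' + v')%MM; split=> //; first by exists u', v'.
(* [b = i] would give back [x], which by [hi] is on the wrong side of [y] at [i]. *)
move: lb hyb hi; rewrite /linked; case: (s) => /mnm_moveP/(_ b);
  rewrite eqxx; case: (eqVneq i b) => [<-|_] /=; rewrite /y !mnmDE; lia.
Qed.

Lemma sum_move x x' i j A : (x' + U_(i) = x + U_(j))%MM ->
  (\sum_(l in A) x' l) + (i \in A) = (\sum_(l in A) x l) + (j \in A).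
Proof.
have sumU k : \sum_(l in A) (k == l) = (k \in A).
  have [kA|kA] := boolP (k \in A).
    by rewrite (bigD1 k) //= eqxx big1 // => l /andP[_]; rewrite eq_sym => /negbTE->.
  by rewrite big1 // => l lA; case: eqVneq => // e; rewrite e lA in kA.
move=> /mnm_moveP h; rewrite -!sumU -!big_split; exact: eq_bigr.
Qed.

(** Move [z] towards [v] by exchanging at indices of [A]. A move inside [A] keeps the sum over [A]
    and lowers the distance to [v], so some move must leave [A]; its target is [b]. *)
Lemma exchange_cross C z v A : exchange true C -> C z -> C v ->
  \sum_(l in A) v l < \sum_(l in A) z l ->
  exists y b, [/\ C y, b \notin A, y b = (z b).+1
    & forall l, l \notin A -> l != b -> y l = z l].
Proof.
move=> eC Cz Cv hz.
suff main N y : dist y v < N -> C y -> (forall l, l \notin A -> y l = z l) ->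
    \sum_(l in A) v l < \sum_(l in A) y l -> 
    exists y b, [/\ C y, b \notin A, y b = (z b).+1
      & forall l, l \notin A -> l != b -> y l = z l].
  exact: main (ltnSn _) Cz _ hz.
elim: N y => // N IH y hN Cy hy hA.
have [i iA hi] : exists2 i, i \in A & v i < y i.
  apply/exists_inP; apply: contraLR hA => /exists_inPn h.
  by rewrite -leqNgt; apply: leq_sum => l lA; rewrite leqNgt h.
have [j [x [Cx hj mv]]] := eC _ _ _ Cy Cv hi.
have hmv l : l \notin A -> x l = y l + (j == l).
  move=> lA; move/mnm_moveP/(_ l): (mv).
  by have [e|_] := eqVneq i l; [rewrite -e iA in lA | rewrite addn0].
have [jA|jA] := boolP (j \in A); last first.
  exists x, j; split=> // [|l lA lj]; first by rewrite hmv // eqxx addn1 hy.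
  by rewrite hmv // eq_sym (negbTE lj) addn0 hy.
apply: (IH x) => //.
- by have := @dist_move true _ _ _ _ _ hi hj mv; lia.
- move=> l lA; rewrite hmv // hy //.
  by have [e|_] := eqVneq j l; [rewrite -e jA in lA | rewrite addn0].
- by have := sum_move A mv; rewrite iA jA; lia.
Qed.

(* [A] consists of the indices which can be increased, starting from a [z] of
   least excess over [w], by decreasing an index at which [z] exceeds [w]. *)
Lemma exchange_separation C w : exchange true C -> exchange false C ->
  (exists z, C z) -> (forall z, C z -> ~~ (z <= w)%MM) ->
  exists z A, [/\ C z, \sum_(l in A) w l < \sum_(l in A) z l
    & forall v, C v -> \sum_(l in A) z l <= \sum_(l in A) v l].
Proof.
move=> eT eF [z0 Cz0] hw.
have [z Cz zmin] : exists2 z, C z & forall z', C z' -> excess z w <= excess z' w.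
  move: {2}(excess z0 w) (leqnn (excess z0 w)) Cz0 => N.
  elim: N z0 => [|N IH] z hN Cz; first by exists z => // z' _; lia.
  have [[z' [Cz' hz']]|no] := classic (exists z', C z' /\ excess z' w < excess z w).
    by apply: (IH z') => //; lia.
  exists z => // z' Cz'; rewrite leqNgt; apply/negP=> h; case: no.
  by exists z'.
pose reach j := exists i x, [/\ w i < z i, C x & (x + U_(i) = z + U_(j))%MM].
pose A := [set j | if excluded_middle_informative (reach j) then true else false].
have AP j : reflect (reach j) (j \in A).
  by rewrite inE; case: excluded_middle_informative => h; constructor.
have overA i : w i < z i -> i \in A by move=> hi; apply/AP; exists i, z.
have leA j : j \in A -> w j <= z j.
  move=> /AP[i [x [hi Cx mv]]]; rewrite leqNgt; apply/negP=> hj.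
  by have := zmin _ Cx; rewrite leqNgt (excess_move mv hi hj).
have [i0 hi0] : exists i, w i < z i.
  move: (hw _ Cz); rewrite -[X in ~~ X]/[forall i, z i <= w i] negb_forall.
  by case/existsP => i; rewrite -ltnNge; exists i.
(* On [A], [z] dominates [w], strictly at [i0]. *)
exists z, A; split=> // [|v Cv].
  have iA := overA _ hi0.
  rewrite (bigD1 i0) //= [ltnRHS](bigD1 i0) //= -addSn leq_add //.
  by apply: leq_sum => l /andP[/leA].
(* If [v] were lighter on [A], one could cross out of [A] at some [b] and exchange back until [b] is
   seen to satisfy [reach]. *)
rewrite leqNgt; apply/negP=> hv.
have [y [b [Cy bA yb yE]]] := exchange_cross eT Cz Cv hv.
have [a [x [Cx ha mvx]]] : exists a x,
    [/\ C x, y a < z a & (x + U_(a) = z + U_(b))%MM].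
  by apply: eF => //; rewrite yb.
have aA : a \in A.
  apply: contraLR ha => aA; have [->|ab] := eqVneq a b; first by rewrite yb; lia.
  by rewrite yE // ltnn.
have [i [x' [hi Cx' mvx']]] := AP _ aA.
have ba : b != a by apply: contraNneq bA => ->.
have ib : i != b by apply: contraNneq bA => <-; exact: overA.
have [eia|ia] := eqVneq i a.
  by case/AP: bA; exists a, x; rewrite -eia in mvx *.
have xb : x' b < x b.
  move/mnm_moveP/(_ b): mvx; move/mnm_moveP/(_ b): mvx'.
  by rewrite (negbTE ib) eq_sym (negbTE ba) eqxx /=; lia.
have [c [r [Cr hc mvr]]] : exists c r,
    [/\ C r, x c < x' c & (r + U_(c) = x' + U_(b))%MM] by apply: eF xb.
(* [x' - x] is [2 U_(a) - U_(i) - U_(b)], positive only at [a]. Hence [r] is [z - U_(i) + U_(b)],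
   which reaches [b]. *)
have eca : c = a.
  apply/eqP; rewrite eq_sym; apply: contraLR hc => ac.
  move/mnm_moveP/(_ c): mvx; move/mnm_moveP/(_ c): mvx'.
  by rewrite (negbTE ac) /=; lia.
case/AP: bA; exists i, r; split=> //; apply/mnmP=> l.
move/mnmP/(_ l): mvx'; move/mnmP/(_ l): mvr.
by rewrite eca !mnmDE; lia.
Qed.

End Exchange.

(** * Exchange between the bases of a discrete polymatroid *)

Section Bases.

Variables (n : nat) (P : {fset 'X_{1..n}}).
Hypothesis polyP : discrete_polymatroid P.
Implicit Types u v x y : 'X_{1..n}.

Lemma base_mdeg_ge x v : is_base P x -> v \in P -> mdeg v <= mdeg x.
Proof.
case: polyP => _ _ aug [xP xmax] vP; rewrite leqNgt; apply/negP=> h.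
have [i [_ xiP]] := aug _ _ xP vP h.
have /mnmP/(_ i) := xmax _ xiP (lem_addr _ _).
by rewrite mnmDE mnm1E eqxx; lia.
Qed.

Lemma mdeg_max_base x : x \in P -> (forall v, v \in P -> mdeg v <= mdeg x) ->
  is_base P x.
Proof.
move=> xP xmax; split=> // v vP xv; apply/mnmP => i.
have := xmax _ vP; rewrite -(submK xv) mdegD => h.
have /eqP : mdeg (v - x) = 0 by lia.
by rewrite mdeg_eq0 => /eqP->; rewrite mnmDE mnm0E.
Qed.

Lemma base_mdeg x v : is_base P x -> v \in P -> mdeg v = mdeg x -> is_base P v.
Proof.
by move=> bx vP e; apply: mdeg_max_base => // u uP; rewrite e; apply: base_mdeg_ge.
Qed.

Lemma base_exists : exists x, is_base P x.
Proof.
case: polyP => /fset0Pn[v0 v0P] _ _.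
case: (arg_maxnP (fun v : P => mdeg (val v)) (isT : xpredT [` v0P]%fset)) => x _ xmax.
by exists (val x); apply: mdeg_max_base (valP x) _ => v vP; apply: (xmax [` vP]%fset).
Qed.

(** Take [U_(i)] off [x] and augment from [y]. The new index is not [i], where [x - U_(i)] is still
    at least [y], and the degree is again that of a base. *)
Lemma base_exchangeT : exchange true (is_base P).
Proof.
case: (polyP) => _ down aug x y i bx by_ hi.
have [xP _] := bx; have [yP _] := by_.
have Uix : (U_(i) <= x)%MM by rewrite lep1mP; lia.
have x'P : (x - U_(i))%MM \in P by apply: down xP _; apply: lem_subr.
have ex := submK Uix.
have dx : mdeg x = mdeg y.
  by apply/eqP; rewrite eqn_leq !base_mdeg_ge.
have dx' : mdeg (x - U_(i)) + 1 = mdeg x by rewrite -[in RHS]ex mdegD mdeg1.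
have [|j [hj zP]] := aug _ _ x'P yP; first by lia.
have e : (x - U_(i) + U_(j) + U_(i) = x + U_(j))%MM
  by apply/mnmP=> l; move/mnmP/(_ l): ex; rewrite !mnmDE; lia.
exists j, (x - U_(i) + U_(j))%MM; split=> //.
  by apply: base_mdeg bx zP _; rewrite mdegD mdeg1.
move: hj; rewrite mnmBE mnm1E; case: (eqVneq i j) => [<-|_] /=; lia.
Qed.

(* Augment [min(x, y) + U_(i)] from [x] until it has the degree of a base. *)
Lemma base_exchangeF : exchange false (is_base P).
Proof.
case: (polyP) => _ down aug x y i bx by_ hi.
have [xP _] := bx; have [yP _] := by_.
suff main N t : mdeg x - mdeg t < N -> t \in P -> t i = (x i).+1 ->
    (forall l, l != i -> minn (x l) (y l) <= t l <= x l) ->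
    exists j x', [/\ is_base P x', y j < x j & (x' + U_(j) = x + U_(i))%MM].
  (* Since [x i < y i], the extra unit at [i] keeps [t] below [y], hence in [P]. *)
  pose t := [multinom minn (x l) (y l) + (l == i) | l < n].
  apply: (main _ t (ltnSn _)).
  - apply: down yP _; apply/mnm_lepP => l; rewrite mnmE.
    by case: eqVneq => [->|_] /=; lia.
  - by rewrite mnmE eqxx; lia.
  - by move=> l li; rewrite mnmE (negbTE li); lia.
elim: N t => // N IH t hN tP ti tl.
have [lt|ge] := ltnP (mdeg t) (mdeg x).
  have [j [hj t'P]] := aug _ _ tP xP lt.
  have ji : j != i by apply: contraTneq hj => ->; rewrite ti; lia.
  apply: (IH _ _ t'P); first by rewrite mdegD mdeg1; lia.
    by rewrite mnmDE mnm1E (negbTE ji) ti addn0.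
  move=> l li; rewrite mnmDE mnm1E; have := tl l li.
  by case: (eqVneq j l) hj => [->|_] /=; lia.
have dt : mdeg t = mdeg x by apply/eqP; rewrite eqn_leq ge base_mdeg_ge.
have tx : (t <= x + U_(i))%MM.
  apply/mnm_lepP => l; rewrite mnmDE mnm1E; case: (eqVneq i l) => [<-|li].
    by rewrite ti addn1.
  by rewrite eq_sym in li; case/andP: (tl l li); rewrite addn0.
have et := submK tx.
have /mdeg1P[j /eqP ej] : mdeg (x + U_(i) - t) == 1.
  have := congr1 mdeg et; rewrite !mdegD mdeg1 dt => h; apply/eqP; lia.
rewrite ej addmC in et.
exists j, t; split=> //; first exact: base_mdeg bx tP dt.
(* The unit missing from [t] is at [j], and [j] is not [i] since [t i] is already [x i + 1]. So
   [t j = x j - 1], and the lower bound [minn (x j) (y j)] on [t j] forces [y j < x j]. *)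
move/mnmP/(_ j): (et); rewrite !mnmDE !mnm1E eqxx.
have [<-|ij] := eqVneq i j; first by rewrite ti /=; lia.
by have := tl j; rewrite eq_sym ij => /(_ isT) /=; lia.
Qed.

End Bases.

Local Open Scope ring_scope.

(** * Generated ideals and primes in a commutative ring *)

Section Ideals.

Variable R : comNzRingType.
Implicit Types (A J Q : R -> Prop).

Lemma ideal_gen_ideal A : is_ideal (ideal_gen A).
Proof.
split=> [|f g [s [sA ->]] [t [tA ->]]|a f [s [sA ->]]].
- by exists [::]; rewrite big_nil.
- exists (s ++ t); rewrite big_cat; split=> // p.
  by rewrite mem_cat => /orP[/sA|/tA].
- exists [seq (a * p.1, p.2) | p <- s]; split=> [p /mapP[q /sA Aq ->] //|].
  by rewrite big_map mulr_sumr; apply: eq_bigr => p _; rewrite mulrA.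
Qed.

Lemma ideal_gen_mem A f : A f -> ideal_gen A f.
Proof.
move=> Af; exists [:: (1, f)]; rewrite big_seq1 mul1r; split=> // p.
by rewrite inE => /eqP->.
Qed.

Lemma ideal_gen_sub A J : is_ideal J -> (forall f, A f -> J f) ->
  forall f, ideal_gen A f -> J f.
Proof.
case=> J0 JD JM AJ f [s [sA ->]]; rewrite big_seq.
by apply: big_ind => // p /sA Ap; apply: JM; apply: AJ.
Qed.

(* A prime ideal which is a finite intersection of ideals is one of them. *)
Lemma prime_avoid (T : eqType) Q (s : seq T) (B : T -> Prop) (J : T -> R -> Prop) :
  is_prime_ideal Q -> (forall u, is_ideal (J u)) ->
  (forall u, u \in s -> B u -> exists g, ~ Q g /\ J u g) ->
  exists g, ~ Q g /\ forall u, u \in s -> B u -> J u g.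
Proof.
move=> [_ Q1 Qprime] Jid; elim: s => [|a s IH] h; first by exists 1.
have [u us|g [nQg Jg]] := IH; first by apply: h; rewrite inE us orbT.
have [Ba|nBa] := classic (B a); last first.
  by exists g; split=> // u; rewrite inE => /orP[/eqP->|] //; apply: Jg.
have [g' [nQg' Jg']] := h a (mem_head _ _) Ba.
exists (g' * g); split=> [/Qprime[]//|u]; rewrite inE => /orP[/eqP-> _|us Bu].
  by rewrite mulrC; case: (Jid a) => _ _; apply.
by case: (Jid u) => _ _; apply; apply: Jg.
Qed.

End Ideals.

(** * Monomial ideals through the supports of their elements *)

Section MonomialIdeals.

Variables (n : nat) (K : fieldType).
Implicit Types (C D M : 'X_{1..n} -> Prop) (f g : {mpoly K[n]}).

Definition above C (m : 'X_{1..n}) := exists u, C u /\ (u <= m)%MM.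

(** By [ideal_genX] this is the ideal generated by the monomials with exponent in [C]; membership
    becomes a question about exponents. *)
Definition mon_ideal C f := forall m, m \in msupp f -> above C m.

Lemma mon_ideal_ideal C : is_ideal (mon_ideal C).
Proof.
split=> [m|f g hf hg m /msuppD_le|a f hf m /msuppM_le].
- by rewrite msupp0.
- by rewrite mem_cat => /orP[/hf|/hg].
case/allpairsP=> -[p q] /= [_ /hf[u [Cu uq]] ->].
by exists u; split=> //; apply: lepm_trans uq (lem_addl _ _).
Qed.

Lemma mon_ideal_sub C (J : {mpoly K[n]} -> Prop) : is_ideal J ->
  (forall u, C u -> J 'X_[u]) -> forall f, mon_ideal C f -> J f.
Proof.
move=> [J0 JD JM] CJ f hf; rewrite [f]mpolyE big_seq.
apply: big_ind => // m /hf[u [Cu um]].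
by rewrite -(submK um) mpolyXD scalerAl; apply: JM; apply: CJ.
Qed.

Lemma mon_idealX C u : mon_ideal C 'X_[u] <-> above C u.
Proof.
split=> [|h m]; first by apply; rewrite msuppX inE.
by rewrite msuppX inE => /eqP->.
Qed.

Lemma ideal_genX M f :
  ideal_gen (fun g => exists u, M u /\ g = 'X_[u]) f <-> mon_ideal M f.
Proof.
split=> [|hf].
  apply: ideal_gen_sub (mon_ideal_ideal M) _ _ => _ [u [Mu ->]].
  by apply/mon_idealX; exists u; split=> //; apply: lepm_refl.
apply: mon_ideal_sub (ideal_gen_ideal _) _ _ hf => u Mu.
by apply: ideal_gen_mem; exists u.
Qed.

Lemma ideal_mul_mon C D (I J : {mpoly K[n]} -> Prop) :
  (forall f, I f <-> mon_ideal C f) -> (forall f, J f <-> mon_ideal D f) ->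
  forall f, ideal_mul I J f <-> mon_ideal (sumset C D) f.
Proof.
move=> IC JD f; split=> [|hf].
  apply: ideal_gen_sub (mon_ideal_ideal _) _ _ => _ [p [q [/IC hp /JD hq ->]]].
  move=> m /msuppM_le/allpairsP[[a b] /= [/hp[u [Cu ua]] /hq[v [Dv vb]] ->]].
  exists (u + v)%MM; split; first by exists u, v.
  apply/mnm_lepP => i; rewrite !mnmDE.
  by apply: leq_add; [apply: (mnm_lepP ua) | apply: (mnm_lepP vb)].
apply: mon_ideal_sub (ideal_gen_ideal _) _ _ hf => w [u [v [Cu Dv ->]]].
apply: ideal_gen_mem; exists 'X_[u], 'X_[v]; split; last exact: mpolyXD.
- by apply/IC/mon_idealX; exists u; split=> //; apply: lepm_refl.
- by apply/JD/mon_idealX; exists v; split=> //; apply: lepm_refl.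
Qed.

(** A monomial of [I] that is not minimal has a proper divisor in [I], of smaller degree, so descent
    ends at a minimal generator. *)
Lemma monomial_ideal_gens (I : {mpoly K[n]} -> Prop) : monomial_ideal I ->
  forall f, I f <-> mon_ideal (min_mon_gen I) f.
Proof.
case=> M IM.
have IX u : I 'X_[u] <-> above M u.
  by split=> [/IM/ideal_genX/mon_idealX|h] //; apply/IM/ideal_genX/mon_idealX.
have minI u : I 'X_[u] -> above (min_mon_gen I) u.
  elim: {u}(mdeg u).+1 {-2}u (ltnSn (mdeg u)) => // N IH u hu Iu.
  have [h|h] := classic (min_mon_gen I u); first by exists u; split=> //; exact: lepm_refl.
  have [v [Iv vu ne]] : exists v, [/\ I 'X_[v], (v <= u)%MM & v <> u].
    apply: NNPP => no; apply: h; split=> // v Iv vu.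
    by apply: NNPP => ne; apply: no; exists v.
  have [|x [Mx xv]] := IH v _ Iv.
    have := submK vu; have := mdegD (u - v) v; case: (eqVneq (u - v)%MM 0%MM) => [->|].
      by rewrite add0m.
    by rewrite -mdeg_eq0 => h0 hD e; rewrite e in hD; lia.
  by exists x; split=> //; apply: lepm_trans xv vu.
split=> [/IM/ideal_genX hf m /hf[u [Mu um]]|hf].
  have [|v [hv vu]] := minI u; last by exists v; split=> //; apply: lepm_trans vu um.
  by apply/IX; exists u; split=> //; apply: lepm_refl.
apply/IM/ideal_genX; apply: mon_ideal_sub (mon_ideal_ideal _) _ _ hf => u [].
by move/IM/ideal_genX.
Qed.

(* If no element of [D] lies below an exponent [m] of [h], then some [A] separates
   [m] from [D]; a [u] in [C] of least weight on [A] contradicts the hypothesis. *)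
Lemma sumset_colon C D h : exchange true D -> exchange false D ->
  (exists u, C u) -> (exists v, D v) ->
  (forall u, C u -> mon_ideal (sumset C D) (h * 'X_[u])) -> mon_ideal D h.
Proof.
move=> eT eF [u0 Cu0] D0 hC m mh; apply: NNPP => no.
have [|z [A [Dz mA zmin]]] := @exchange_separation _ D m eT eF D0.
  by move=> z Dz; apply/negP => zm; apply: no; exists z.
pose wt (u : 'X_{1..n}) := (\sum_(l in A) u l)%N.
have [u Cu umin] : exists2 u, C u & forall v, C v -> (wt u <= wt v)%N.
  elim: {u0}(wt u0).+1 {-2}u0 (ltnSn (wt u0)) Cu0 => // N IH u hu Cu.
  have [[v [Cv vu]]|no'] := classic (exists v, C v /\ (wt v < wt u)%N).
    by apply: (IH v) => //; lia.
  exists u => // v Cv; rewrite leqNgt; apply/negP => vu.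
  by case: no'; exists v.
have [|_ [[p [q [Cp Dq ->]]] le]] := hC u Cu (m + u)%MM.
  by rewrite (perm_mem (msuppMX _ _)) addmC; apply: map_f.
have : (wt (p + q)%MM <= wt (m + u)%MM)%N by apply: leq_sum => l _; apply: (mnm_lepP le).
have wtD a b : wt (a + b)%MM = (wt a + wt b)%N.
  by rewrite /wt -big_split; apply: eq_bigr => l _; rewrite mnmDE.
(* [p + q] lies below [m + u], yet [p] weighs at least as much as [u], and [q] at least as much as
   [z], which outweighs [m]. *)
have := umin _ Cp; have : (wt z <= wt q)%N := zmin _ Dq.
by move: mA; rewrite !wtD -!/(wt _); lia.
Qed.

End MonomialIdeals.

(** * Powers of the ideal and persistence *)

Fixpoint sumset_exp n (C : 'X_{1..n} -> Prop) (k : nat) : 'X_{1..n} -> Prop :=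
  if k is k'.+1 then sumset C (sumset_exp C k') else fun u => u = 0%MM.

Lemma sumset_exp_exists n (C : 'X_{1..n} -> Prop) k :
  (exists u, C u) -> exists u, sumset_exp C k u.
Proof.
move=> [u Cu]; elim: k => [|k [v hv]]; first by exists 0%MM.
by exists (u + v)%MM; exists u, v.
Qed.

Lemma exchange_sumset_exp n s (C : 'X_{1..n} -> Prop) k :
  exchange s C -> exchange s (sumset_exp C k).
Proof.
move=> eC; elim: k => [x y i -> ->|k IH]; last exact: exchange_sumset.
by case: s {eC}; rewrite ltnn.
Qed.

Lemma ideal_exp_mon n (K : fieldType) C (I : {mpoly K[n]} -> Prop) k :
  (forall f, I f <-> mon_ideal C f) ->
  forall f, ideal_exp I k f <-> mon_ideal (sumset_exp C k) f.
Proof.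
move=> IC; elim: k => [f|k IH]; last exact: ideal_mul_mon.
(* The zeroth power is the whole ring, generated by the monomial of exponent 0. *)
split=> // _ m _; exists 0%MM; split=> //; apply/mnm_lepP => i.
by rewrite mnm0E.
Qed.

Theorem proposition2p3 (n : nat) (K : fieldType) (I : {mpoly K[n]} -> Prop) :
  polymatroidal_ideal I -> persistence_property I.
Proof.
move=> [monI [P [polyP genP]]] k _ Q [primeQ [f Qf]]; split=> //.
have IB : forall g, I g <-> mon_ideal (is_base P) g.
  move=> g; rewrite (monomial_ideal_gens monI).
  by split=> h m /h[u [/genP bu um]]; exists u; split.
have Ik j := ideal_exp_mon j IB.
have B0 := base_exists polyP.
have [I0 ID IM] : is_ideal (ideal_exp I k.+1) by apply: ideal_gen_ideal.
have fwd u g : is_base P u -> Q g -> ideal_exp I k.+1 (g * (f * 'X_[u])).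
  move=> bu /Qf hg; apply: ideal_gen_mem; exists 'X_[u], (g * f).
  split=> //; last by rewrite mulrA mulrC.
  by apply/IB/mon_idealX; exists u; split=> //; apply: lepm_refl.
(* If no [f * 'X_[u]] works, each [J u] with [u] a base strictly contains [Q], and [prime_avoid]
   yields a common element [G] outside [Q]. *)
apply: NNPP => no.
pose J u g := ideal_exp I k.+1 (g * (f * 'X_[u])).
have [u|u uP bu|G [nQG JG]] := @prime_avoid _ _ Q (enum_fset P) (is_base P) J primeQ.
- split=> [|g h Jg Jh|a g Jg]; rewrite /J.
  + by rewrite mul0r.
  + by rewrite mulrDl; apply: ID.
  + by rewrite -mulrA; apply: IM.
- apply: NNPP => no'; apply: no; exists (f * 'X_[u]) => g; split; first exact: fwd.
  by move=> Jg; apply: NNPP => nQg; apply: no'; exists g.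
(* [G * f] times each generator of [I] lies in I^(k+1), so [sumset_colon] puts [G * f] in I^k, that
   is, [G] in [Q]. *)
apply: nQG; apply/Qf/Ik.
apply: sumset_colon (exchange_sumset_exp (base_exchangeT polyP))
  (exchange_sumset_exp (base_exchangeF polyP)) B0 (sumset_exp_exists _ B0) _ => u bu.
by rewrite -mulrA; apply/(Ik k.+1); apply: JG => //; case: bu.
Qed.
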